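(* Let $p>5$ be a prime, $a\in\mathbb Z_p$ with $a\not\equiv-1\pmod p$, and $a'=(a-\langle a\rangle_p)/p$. Then $$\sum_{k=0}^{p-1}k^3\binom ak\binom{-1-a}k\binom{2k}k\frac1{4^k}\equiv\frac{a^2(a+1)^2(2a+1)^2}{15}S_p(a)-\frac{(a+1)^2\big(4a^2(a+1)^2-a(a+1)+1\big)}{15}S_p(a+1)+\frac{4a^4+6a^3-a^2+a+5}{15(a+1)}a'(a'+1)p^3\pmod{p^4}.$$
   Context: For a prime $p$, $\mathbb Z_p$ denotes the set of rational numbers whose denominator is not divisible by $p$, and congruences modulo powers of $p$ are between elements of $\mathbb Z_p$ (the difference divided by that power of $p$ lies in $\mathbb Z_p$). For $a\in\mathbb Z_p$, $\langle a\rangle_p\in\{0,1,\ldots,p-1\}$ is determined by $a\equiv\langle a\rangle_p\pmod p$. For rational $a$ and integer $k\ge0$, $\binom ak=a(a-1)\cdots(a-k+1)/k!$. Define $S_n(a)=\sum_{k=0}^{n-1}\binom ak\binom{-1-a}k\binom{2k}k\frac1{4^k}$ for $n\ge1$. *)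

(* Defs.v *)
From mathcomp Require Import all_boot all_order all_algebra.

Set Implicit Arguments.
Unset Strict Implicit.
Unset Printing Implicit Defensive.

Import Order.TTheory GRing.Theory Num.Theory.
Local Open Scope ring_scope.

(* Membership in Z_p, the localisation of the integers at p inside rat. *)
Definition pintegral (p : nat) (x : rat) : bool := ~~ (p %| `|denq x|)%N.

(* x = y modulo p ^ m, for x and y in Z_p. *)
Definition pcongr (p m : nat) (x y : rat) : bool :=
  pintegral p ((x - y) / p%:R ^+ m).

(* The representative <a>_p in {0, ..., p - 1} of a in Z_p; the search always
   succeeds when p is prime and a is in Z_p, see [presidueP] below. *)
Definition presidue (p : nat) (a : rat) : nat :=
  find (fun r => pcongr p 1 a r%:R) (iota 0 p).

Definition gbinom (a : rat) (k : nat) : rat :=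
  (\prod_(i < k) (a - i%:R)) / k`!%:R.

Definition Ssum (n : nat) (a : rat) : rat :=
  \sum_(k < n) gbinom a k * gbinom (-1 - a) k * 'C(2 * k, k)%:R / 4 ^+ k.

Lemma pcongr1E p a (r : nat) : prime p -> pintegral p a ->
  pcongr p 1 a r%:R = (p%:Z %| numq a - r%:Z * denq a)%Z.
Proof.
move=> p_pr pa; rewrite /pcongr expr1.
have p0 : p%:R != 0 :> rat by rewrite pnatr_eq0 -lt0n prime_gt0.
have d0 : (denq a)%:~R != 0 :> rat by rewrite intr_eq0 denq_neq0.
have aE : a * (denq a)%:~R = (numq a)%:~R by rewrite numqE.
set y := (a - r%:R) / p%:R.
have yE : y * p%:R * (denq a)%:~R = (numq a - r%:Z * denq a)%:~R.
  by rewrite divfK // mulrBl aE rmorphB rmorphM.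
move: y yE => y yE.
have zE : numq y * p%:Z * denq a = (numq a - r%:Z * denq a) * denq y.
  apply/eqP; rewrite -(eqr_int rat) !rmorphM /= -yE (numqE y); apply/eqP.
  by rewrite -!mulrA; congr (_ * _); rewrite mulrC mulrA.
have cop_a : coprimez p%:Z (denq a) by rewrite coprimezE prime_coprime.
apply/idP/idP => [py|/dvdzP[c cE]].
  have cop : coprimez p%:Z (denq y) by rewrite coprimezE prime_coprime.
  by rewrite -(Gauss_dvdzl _ cop) -zE -mulrA dvdz_mull // dvdz_mulr.
rewrite /pintegral; apply/negP => pd.
have y_c : numq y * denq a = c * denq y.
  have pz : p%:Z != 0 by rewrite eqz_nat -lt0n prime_gt0.
  apply: (mulIf pz).
  by rewrite mulrAC zE cE mulrAC.
have : (p%:Z %| numq y * denq a)%Z.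
  by rewrite y_c dvdz_mull // dvdzE.
rewrite (Gauss_dvdzl _ cop_a) dvdzE /= => pn.
have := coprime_num_den y; rewrite /coprime => /eqP g1.
have : (p %| gcdn `|numq y| `|denq y|)%N by rewrite dvdn_gcd pn.
by rewrite g1 Euclid_dvd1.
Qed.

Lemma presidueP p a : prime p -> pintegral p a ->
  (presidue p a < p)%N && pcongr p 1 a (presidue p a)%:R.
Proof.
move=> p_pr pa.
have h : has (fun r => pcongr p 1 a r%:R) (iota 0 p).
  have /coprimezP[[u v] /= uv] : coprimez p%:Z (denq a)
    by rewrite coprimezE prime_coprime.
  have pz : p%:Z != 0 by rewrite eqz_nat -lt0n prime_gt0.
  have := modz_ge0 (v * numq a) pz.
  have := ltz_pmod (v * numq a) (_ : 0 < p%:Z).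
  move/(_ (prime_gt0 p_pr)).
  have := divz_eq (v * numq a) p%:Z.
  case: (_ %% _)%Z => // r e r_lt _.
  apply/hasP; exists r; first by rewrite mem_iota.
  rewrite pcongr1E //.
  have -> : r%:Z = v * numq a - (v * numq a %/ p%:Z)%Z * p%:Z.
    by rewrite [X in X - _]e addrAC subrr add0r.
  rewrite mulrBl opprB addrCA rpredD //.
    by rewrite mulrAC dvdz_mull.
  rewrite mulrAC -{1}[numq a]mul1r -uv -mulrBl addrK mulrAC.
  by rewrite dvdz_mull.
have lt_p : (presidue p a < p)%N by rewrite /presidue -[X in (_ < X)%N](size_iota 0 p) -has_find.
rewrite lt_p /=.
by have := nth_find 0%N h; rewrite nth_iota.
Qed.

(* Main.v *)
(* Write t_k(a) for the k-th term of S_n(a).  Gosper summation gives an exact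
   evaluation of \sum_(k < n) k^3 t_k(a) as the stated combination of S_n(a) and
   S_n(a+1) plus n^3 q(n) t_n(a) / (a + 1 - n), where q is a quadratic
   polynomial.  For n = p the factor p^3 reduces the claim to a congruence
   modulo p, in which only t_p(a) is needed.  Writing a = r + p a' with
   0 <= r < p, Lucas' congruence binom(r + p c, p) = c mod p, applied to a, to
   -1 - a = (p - 1 - r) - p (a' + 1) and to 2p, together with Fermat's
   4^p = 4, gives t_p(a) = - a' (a' + 1) / 2 mod p. *)
Require Import Defs.
From mathcomp Require Import all_boot all_order all_algebra.
From mathcomp Require Import ring zify.

Import Order.TTheory GRing.Theory Num.Theory.
Local Open Scope ring_scope.

(** * Ring structure and units of the localisation at [p] *)

(** The reduced denominator divides every denominator, being coprime to [numq x]; so any fraction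
    for [x], reduced or not, witnesses integrality. *)
Lemma pintegral_mulr_nat (p d : nat) (m : int) (x : rat) :
  prime p -> ~~ (p %| d)%N -> x * d%:R = m%:~R -> pintegral p x.
Proof.
move=> p_pr pd xd; apply: contra pd => /dvdn_trans; apply.
have : (denq x %| numq x * d)%Z.
  apply/dvdzP; exists m; apply/eqP.
  by rewrite -(eqr_int rat) !rmorphM /= -xd numqE mulrAC.
rewrite Gauss_dvdzr; first by rewrite dvdzE.
by rewrite coprimezE coprime_sym coprime_num_den.
Qed.

Lemma pintegralE (p : nat) (x : rat) :
  pintegral p x -> exists (m : int) (d : nat), ~~ (p %| d)%N /\ x * d%:R = m%:~R.
Proof.
move=> px; exists (numq x), `|denq x|%N; split=> //.
by rewrite numqE -(gez0_abs (ltW (denq_gt0 x))).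
Qed.

Lemma pintegral_int (p : nat) (m : int) : prime p -> pintegral p m%:~R.
Proof.
move=> p_pr; apply: (@pintegral_mulr_nat p 1 m) => //; last by rewrite mulr1.
by rewrite Euclid_dvd1.
Qed.

Lemma pintegral_nat (p n : nat) : prime p -> pintegral p n%:R.
Proof. exact: (@pintegral_int p n). Qed.

Lemma pintegralD (p : nat) (x y : rat) :
  prime p -> pintegral p x -> pintegral p y -> pintegral p (x + y).
Proof.
move=> p_pr /pintegralE[m [d [pd xd]]] /pintegralE[n [e [pe ye]]].
apply: (@pintegral_mulr_nat p (d * e)%N (m * e%:Z + n * d%:Z)) => //.
  by rewrite Euclid_dvdM // negb_or pd.
by rewrite natrM rmorphD !rmorphM /= -xd -ye; ring.
Qed.

Lemma pintegralM (p : nat) (x y : rat) :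
  prime p -> pintegral p x -> pintegral p y -> pintegral p (x * y).
Proof.
move=> p_pr /pintegralE[m [d [pd xd]]] /pintegralE[n [e [pe ye]]].
apply: (@pintegral_mulr_nat p (d * e)%N (m * n)) => //.
  by rewrite Euclid_dvdM // negb_or pd.
by rewrite natrM rmorphM /= -xd -ye; ring.
Qed.

Lemma pintegralN (p : nat) (x : rat) :
  prime p -> pintegral p x -> pintegral p (- x).
Proof.
by move=> p_pr px; rewrite -mulN1r; apply: pintegralM => //;
  apply: (@pintegral_int p (-1)).
Qed.

Lemma pintegralB (p : nat) (x y : rat) :
  prime p -> pintegral p x -> pintegral p y -> pintegral p (x - y).
Proof. by move=> p_pr px py; apply: pintegralD => //; apply: pintegralN. Qed.

Lemma pintegralX (p n : nat) (x : rat) :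
  prime p -> pintegral p x -> pintegral p (x ^+ n).
Proof.
move=> p_pr px; elim: n => [|n IHn]; first exact: (@pintegral_nat p 1).
by rewrite exprS; apply: pintegralM.
Qed.

(** The two integrality hypotheses say that [x] has valuation exactly 0, hence is a unit. *)
Lemma pintegralV (p : nat) (x : rat) :
  prime p -> pintegral p x -> ~~ pintegral p (x / p%:R) -> pintegral p x^-1.
Proof.
move=> p_pr /pintegralE[m [d [pd xd]]] npx.
have p0 : p%:R != 0 :> rat by rewrite pnatr_eq0 -lt0n prime_gt0.
have pm : ~~ (p %| `|m|)%N.
  apply: contra npx => pm; have /dvdzP[c mE] : (p%:Z %| m)%Z by rewrite dvdzE.
  apply: (@pintegral_mulr_nat p d c) => //.
  by rewrite mulrAC xd mE rmorphM /= mulfK.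
have m0 : m%:~R != 0 :> rat.
  by rewrite intr_eq0; apply: contraNneq pm => ->; rewrite dvdn0.
have x0 : x != 0 by apply: contraNneq m0 => x0; rewrite -xd x0 mul0r.
(* The inverse is [d / m]; a negative sign of [m] moves to the numerator, since the denominator has
   to be a natural number. *)
case: m xd pm m0 => n xd pn n0.
  by apply: (@pintegral_mulr_nat p n d) => //; rewrite (_ : n%:R = x * d%:R) ?mulKf.
apply: (@pintegral_mulr_nat p n.+1 (- d%:Z)) => //.
apply: (mulfI x0); rewrite mulVKf // rmorphN mulrN /= [x * _]xd NegzE rmorphN.
by rewrite /= opprK.
Qed.

Lemma pintegral_invn (p n : nat) :
  prime p -> ~~ (p %| n)%N -> pintegral p n%:R^-1.
Proof.
move=> p_pr pn; apply: (@pintegral_mulr_nat p n 1) => //.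
by rewrite mulVf // pnatr_eq0; apply: contraNneq pn => ->; rewrite dvdn0.
Qed.

(** * Binomial recurrences with rational upper argument *)

Lemma natrS_neq0 (n : nat) : 1 + n%:R != 0 :> rat.
Proof. by rewrite addrC natr1 pnatr_eq0. Qed.

Lemma gbinomS (a : rat) (k : nat) :
  gbinom a k.+1 = gbinom a k * (a - k%:R) / k.+1%:R.
Proof.
rewrite /gbinom big_ord_recr /= factS natrM.
have h : k`!%:R != 0 :> rat by rewrite pnatr_eq0 -lt0n fact_gt0.
have h' := natrS_neq0 k.
by field; rewrite h' h.
Qed.

(** Absorption: the first factor of the product for [a + 1] is [a + 1], and the others are those for
    [a]. *)
Lemma gbinomD1 (a : rat) (k : nat) :
  gbinom (a + 1) k.+1 = (a + 1) / k.+1%:R * gbinom a k.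
Proof.
rewrite /gbinom big_ord_recl /= factS natrM subr0.
under eq_bigr => i _ do rewrite /bump /= natrD opprD addrA addrK.
have h : k`!%:R != 0 :> rat by rewrite pnatr_eq0 -lt0n fact_gt0.
have h' := natrS_neq0 k.
by field; rewrite h' h.
Qed.

Lemma gbinom_pascal (a : rat) (k : nat) :
  gbinom (a + 1) k.+1 = gbinom a k.+1 + gbinom a k.
Proof.
rewrite gbinomD1 gbinomS.
have h' := natrS_neq0 k.
by field.
Qed.

(** Makes binom(2p, p) accessible to the congruences proved for [gbinom]. *)
Lemma gbinom_nat (n k : nat) : gbinom n%:R k = 'C(n, k)%:R.
Proof.
elim: n k => [|n IHn] [|k].
- by rewrite /gbinom big_ord0 divr1.
- by rewrite /gbinom big_ord_recl /= subrr !mul0r.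
- by rewrite /gbinom big_ord0 divr1 bin0.
- by rewrite -natr1 gbinom_pascal !IHn binS natrD.
Qed.

Lemma central_binS (n : nat) :
  'C(2 * n.+1, n.+1)%:R = 'C(2 * n, n)%:R * (2 * (2 * n%:R + 1)) / n.+1%:R :> rat.
Proof.
have h' := natrS_neq0 n.
have e : (n.+1 * 'C(2 * n.+1, n.+1) = 2 * (2 * n + 1) * 'C(2 * n, n))%N.
  (* Both identities pass through binom(2n+1, n), which is then eliminated. *)
  have e1 := mul_bin_diag (2 * n.+1) n.
  have e2 := mul_bin_down (2 * n).+1 n.
  rewrite (_ : (2 * n.+1).-1 = (2 * n).+1) in e1; last by rewrite mulnS.
  rewrite (_ : (2 * n).+1 - n = n.+1)%N in e2; last by lia.
  by move: e1 e2 => /=; move: 'C(_, _) 'C(_, _) 'C(_, _) => x y z; lia.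
apply: (mulfI h'); rewrite nat1r -[LHS]natrM e !natrM natrD natrM.
by field.
Qed.

(** * Recurrences of the summand and telescoping *)

Definition summand (a : rat) (k : nat) : rat :=
  gbinom a k * gbinom (-1 - a) k * 'C(2 * k, k)%:R / 4 ^+ k.

Lemma SsumE (n : nat) (a : rat) : Ssum n a = \sum_(k < n) summand a k.
Proof. by []. Qed.

Lemma summandS (a : rat) (n : nat) :
  summand a n.+1 =
  - summand a n * (a - n%:R) * (a + 1 + n%:R) * (2 * n%:R + 1) / (2 * n.+1%:R ^+ 3).
Proof.
have h' := natrS_neq0 n.
rewrite /summand !gbinomS central_binS exprS.
have h4 : 4 ^+ n != 0 :> rat by rewrite expf_neq0.
by field; rewrite h4 h'.
Qed.

(** Together with [summandS], this reduces the new terms of both S(a) and S(a+1) to multiples of the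
    single quantity [summand a n]. *)
Lemma summandD1S (a : rat) (n : nat) : a + 1 != 0 ->
  summand (a + 1) n.+1 =
  - summand a n * (a + 1 + n%:R) * (a + 2 + n%:R) * (2 * n%:R + 1) / (2 * n.+1%:R ^+ 3).
Proof.
move=> a1; have h' := natrS_neq0 n.
have h4 : 4 ^+ n != 0 :> rat by rewrite expf_neq0.
have e : gbinom (-1 - (a + 1)) n.+1 =
    gbinom (-1 - a) n * (a + 1 + n%:R) * (a + 2 + n%:R) / (- (a + 1) * n.+1%:R).
  have h2 : 2 + n%:R != 0 :> rat by rewrite -natrD pnatr_eq0.
  (* Absorption is used backwards, from upper argument -1-a down to -2-a; this divides by -(a+1),
     whence the hypothesis on [a]. *)
  have b0 : (-1 - (a + 1) + 1) / n.+2%:R != 0.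
    by rewrite (_ : _ + 1 = - (a + 1))
      ?mulf_neq0 ?oppr_eq0 ?invr_neq0 ?pnatr_eq0 //; ring.
  apply: (mulfI b0); rewrite -gbinomD1.
  rewrite (_ : -1 - (a + 1) + 1 = -1 - a); last by ring.
  by rewrite !gbinomS; field; rewrite h' a1 h2.
rewrite /summand gbinomD1 e central_binS exprS.
by field; rewrite h4 h' a1.
Qed.

(* The coefficients of [n.+1%:R] solve the linear system expressing that the
   summands telescope (Gosper's method). *)
Lemma sum_cubes_telescope (a : rat) (n : nat) : a + 1 != 0 ->
  \sum_(k < n.+1) k%:R ^+ 3 * summand a k =
  a ^+ 2 * (a + 1) ^+ 2 * (2 * a + 1) ^+ 2 / 15 * Ssum n.+1 a
  - (a + 1) ^+ 2 * (4 * a ^+ 2 * (a + 1) ^+ 2 - a * (a + 1) + 1) / 15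
    * Ssum n.+1 (a + 1)
  + (2 * (4 * a ^+ 4 + 6 * a ^+ 3 - a ^+ 2 + a + 5)
     + (4 * a ^+ 2 - 2 * a - 14) * n.+1%:R + 6 * n.+1%:R ^+ 2) / 15
    * (a + 1 + n%:R) * (2 * n%:R + 1) / 2 * summand a n.
Proof.
move=> a1; rewrite !SsumE.
elim: n => [|n IHn].
  rewrite !big_ord_recl !big_ord0 /= /summand /gbinom !big_ord0.
  by field.
rewrite !(big_ord_recr n.+1) /= IHn summandD1S // summandS -(nat1r n.+1) -(nat1r n).
have h' := natrS_neq0 n.
move: (n%:R) (summand a n) h' (\sum_(i < _) _) (\sum_(i < _) _) => N T h' X Y.
by field.
Qed.

(** * Calculus of congruences *)

Lemma pcongr_refl (p m : nat) (x : rat) : prime p -> pcongr p m x x.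
Proof. by move=> p_pr; rewrite /pcongr subrr mul0r; apply: (@pintegral_nat p 0). Qed.

Lemma pcongrN (p m : nat) (x y : rat) : prime p ->
  pcongr p m x y -> pcongr p m (- x) (- y).
Proof. by move=> p_pr /(pintegralN _ _ p_pr); rewrite -mulNr opprD. Qed.

Lemma pcongrD (p m : nat) (x y z t : rat) : prime p ->
  pcongr p m x y -> pcongr p m z t -> pcongr p m (x + z) (y + t).
Proof.
move=> p_pr xy zt; rewrite /pcongr opprD addrACA mulrDl.
exact: pintegralD.
Qed.

Lemma pcongr_pintegral (p m : nat) (x y : rat) : prime p ->
  pintegral p y -> pcongr p m x y -> pintegral p x.
Proof.
move=> p_pr py xy; have p0 : p%:R ^+ m != 0 :> rat.
  by rewrite expf_neq0 // pnatr_eq0 -lt0n prime_gt0.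
rewrite -(subrK y x) -(divfK p0 (x - y)).
by apply: pintegralD => //; apply: pintegralM => //; apply/pintegralX/pintegral_nat.
Qed.

Lemma pcongrM (p m : nat) (x y z t : rat) : prime p ->
  pintegral p y -> pintegral p t ->
  pcongr p m x y -> pcongr p m z t -> pcongr p m (x * z) (y * t).
Proof.
move=> p_pr py pt xy zt; rewrite /pcongr.
have -> : (x * z - y * t) / p%:R ^+ m =
    (x - y) / p%:R ^+ m * z + y * ((z - t) / p%:R ^+ m) by ring.
by apply: pintegralD => //; apply: pintegralM => //;
  apply: (pcongr_pintegral _ _ _ _ p_pr pt zt).
Qed.

Lemma pcongrV (p m : nat) (x y : rat) : prime p -> x != 0 -> y != 0 ->
  pintegral p x^-1 -> pintegral p y^-1 ->
  pcongr p m x y -> pcongr p m x^-1 y^-1.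
Proof.
move=> p_pr x0 y0 px py xy; rewrite /pcongr.
have p0 : p%:R ^+ m != 0 :> rat by rewrite expf_neq0 // pnatr_eq0 -lt0n prime_gt0.
have -> : (x^-1 - y^-1) / p%:R ^+ m = - ((x - y) / p%:R ^+ m) * x^-1 * y^-1.
  by field; rewrite x0 y0 p0.
by do 2!apply: pintegralM => //; apply: pintegralN.
Qed.

Lemma pcongr_mod (p m n : nat) : prime p -> (m = n %[mod p])%N ->
  pcongr p 1 m%:R n%:R.
Proof.
move=> p_pr mn; have p0 : p%:R != 0 :> rat by rewrite pnatr_eq0 -lt0n prime_gt0.
rewrite /pcongr (divn_eq m p) (divn_eq n p) mn !natrD !natrM opprD addrACA subrr.
rewrite addr0 -mulrBl mulfK //.
by apply: pintegralB => //; apply: pintegral_nat.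
Qed.

Lemma pcongr_addMp (p : nat) (x z : rat) : prime p -> pintegral p z ->
  pcongr p 1 (x + p%:R * z) x.
Proof.
move=> p_pr pz; have p0 : p%:R != 0 :> rat by rewrite pnatr_eq0 -lt0n prime_gt0.
by rewrite /pcongr addrAC subrr add0r expr1 mulrAC divff // mul1r.
Qed.

(** * Lucas congruences and the value of the summand at [p] *)

Lemma pintegral_factV (p n : nat) : prime p -> (n < p)%N -> pintegral p n`!%:R^-1.
Proof.
move=> p_pr; elim: n => [|n IHn] np.
  by apply: (pintegral_invn _ 1) => //; rewrite Euclid_dvd1.
rewrite factS natrM invfM; apply: pintegralM => //; last exact/IHn/ltnW.
by apply: pintegral_invn => //; rewrite gtnNdvd.
Qed.

(** Each factor (pc - 1 - i)/(i + 1) with i < k is -1 modulo p, because i + 1 < p is a unit. *)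
Lemma gbinom_pmulB1 (p k : nat) (c : rat) : prime p -> pintegral p c ->
  (k < p)%N -> pcongr p 1 (gbinom (p%:R * c - 1) k) ((-1) ^+ k).
Proof.
move=> p_pr pc; elim: k => [|k IHk] kp.
  by rewrite /gbinom big_ord0 divr1; apply: pcongr_refl.
have pk : pintegral p k.+1%:R^-1 by apply: pintegral_invn => //; rewrite gtnNdvd.
have h' := natrS_neq0 k.
rewrite gbinomS exprSr -mulrA.
rewrite (_ : _ / _ = -1 + p%:R * (c / k.+1%:R)); last by field.
apply: pcongrM => //; last by apply: pcongr_addMp => //; apply: pintegralM.
- exact/pintegralX/(@pintegral_int p (-1)).
- exact: (@pintegral_int p (-1)).
- exact/IHk/ltnW.
Qed.

(** The factor of index [r] in the numerator is exactly pc, while (p-1)! is a unit. *)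
Lemma gbinom_pred_congr0 (p r : nat) (c : rat) : prime p -> pintegral p c ->
  (r < p.-1)%N -> pcongr p 1 (gbinom (r%:R + p%:R * c) p.-1) 0.
Proof.
move=> p_pr pc rp; have p0 : p%:R != 0 :> rat by rewrite pnatr_eq0 -lt0n prime_gt0.
rewrite /pcongr subr0 expr1 /gbinom (bigD1 (Ordinal rp)) //=.
rewrite (_ : r%:R + p%:R * c - r%:R = p%:R * c); last by ring.
have f0 : p.-1`!%:R != 0 :> rat by rewrite pnatr_eq0 -lt0n fact_gt0.
set X := \prod_(_ | _) _.
have -> : p%:R * c * X / p.-1`!%:R / p%:R = c * X / p.-1`!%:R by field; rewrite p0 f0.
apply: pintegralM => //; last by apply: pintegral_factV; rewrite ?ltn_predL ?prime_gt0.
apply: pintegralM => //; apply: (big_ind (fun x => pintegral p x)) => [|x y|i _].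
- exact: (@pintegral_nat p 1).
- exact: pintegralM.
- apply: pintegralB => //; last exact: pintegral_nat.
  by apply: pintegralD => //; [|apply: pintegralM => //]; apply: pintegral_nat.
Qed.

(** Induction on [r]. For r = 0, absorption gives c binom(pc-1, p-1), and (-1)^(p-1) = 1 as p is
    odd. Pascal's rule then adds binom(r+pc, p-1), which vanishes modulo p while r < p-1. *)
Lemma gbinom_lucas (p r : nat) (c : rat) : prime p -> odd p -> pintegral p c ->
  (r < p)%N -> pcongr p 1 (gbinom (r%:R + p%:R * c) p) c.
Proof.
move=> p_pr p_odd pc; have p_gt0 := prime_gt0 p_pr.
have p0 : p%:R != 0 :> rat by rewrite pnatr_eq0 -lt0n.
elim: r => [|r IHr] rp.
  have := gbinomD1 (p%:R * c - 1) p.-1.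
  rewrite add0r subrK prednK // (mulrAC p%:R) divff // mul1r => ->.
  rewrite -[X in pcongr _ _ _ X]mulr1.
  apply: pcongrM => //; [exact: (@pintegral_nat p 1)|exact: pcongr_refl|].
  rewrite [X in pcongr _ _ _ X](_ : 1 = (-1) ^+ p.-1); last first.
    by rewrite -signr_odd -subn1 oddB // p_odd.
  by apply: (gbinom_pmulB1 p p.-1 c) => //; rewrite ltn_predL.
have := gbinom_pascal (r%:R + p%:R * c) p.-1.
rewrite -natr1 addrAC prednK // => ->; rewrite -[X in pcongr _ _ _ X]addr0.
apply: pcongrD => //; first exact/IHr/ltnW.
by apply: gbinom_pred_congr0 => //; rewrite -ltnS prednK.
Qed.

Lemma summand_prime (p r : nat) (c : rat) : prime p -> odd p -> pintegral p c ->
  (r < p)%N ->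
  pcongr p 1 (summand (r%:R + p%:R * c) p) (- (c * (c + 1)) / 2).
Proof.
move=> p_pr p_odd pc rp.
have p4 : ~~ (p %| 4)%N.
  by rewrite (Euclid_dvdX 2 2) // andbT dvdn_prime2 //; apply: contraTneq p_odd => ->.
have p4p : ~~ (p %| 4 ^ p)%N by rewrite Euclid_dvdX // negb_and p4.
have pint2 := @pintegral_nat p 2 p_pr; have pint1 := @pintegral_nat p 1 p_pr.
have pc1 : pintegral p (- (c + 1)) by apply/pintegralN/pintegralD.
(* The target is split into the residues of the four factors of the summand, in their order. *)
have -> : - (c * (c + 1)) / 2 = c * - (c + 1) * 2 / 4 by field.
rewrite /summand; apply: pcongrM => //; first by do 2!apply: pintegralM => //.
- apply: pcongrM => //; first exact: pintegralM.
    apply: pcongrM => //; first exact: gbinom_lucas.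
    rewrite (_ : -1 - _ = (p - r.+1)%:R + p%:R * - (c + 1)).
      by apply: gbinom_lucas => //; lia.
    by rewrite natrB // -natr1; ring.
  (* binom(2p, p) is the Lucas case r = 0, c = 2. *)
  rewrite -gbinom_nat natrM mulrC -[p%:R * 2]add0r.
  by apply: (@gbinom_lucas p 0) => //; apply: prime_gt0.
- rewrite -natrX; apply: pcongrV; rewrite ?pnatr_eq0 ?expn_eq0 //.
  + exact: pintegral_invn.
  + exact/pcongr_mod/fermat_little.
Qed.

(** * Reduction from modulus p^4 to modulus p *)

Theorem theorem7p2 (p : nat) (a : rat) (p_prime : prime p) (p_gt5 : (5 < p)%N)
    (a_int : pintegral p a) (a_neqN1 : ~~ pcongr p 1 a (-1)) :
  let a' : rat := (a - (presidue p a)%:R) / p%:R in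
  pcongr p 4
    (\sum_(k < p) k%:R ^+ 3 *
       (gbinom a k * gbinom (-1 - a) k * 'C(2 * k, k)%:R / 4 ^+ k))
    (a ^+ 2 * (a + 1) ^+ 2 * (2 * a + 1) ^+ 2 / 15 * Ssum p a
     - (a + 1) ^+ 2 * (4 * a ^+ 2 * (a + 1) ^+ 2 - a * (a + 1) + 1) / 15
       * Ssum p (a + 1)
     + (4 * a ^+ 4 + 6 * a ^+ 3 - a ^+ 2 + a + 5) / (15 * (a + 1))
       * a' * (a' + 1) * p%:R ^+ 3).
Proof.
cbv zeta; set a' : rat := (a - _) / _; have /andP[r_lt ra] := presidueP p_prime a_int.
have p0 : p%:R != 0 :> rat by rewrite pnatr_eq0 -lt0n prime_gt0.
have pa' : pintegral p a' by move: ra; rewrite /pcongr expr1.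
have aE : a = (presidue p a)%:R + p%:R * a' by rewrite /a'; field.
have pnat := fun n => @pintegral_nat p n p_prime.
have pD x y := pintegralD p x y p_prime; have pM x y := pintegralM p x y p_prime.
have pN x := pintegralN p x p_prime; have pX n x := pintegralX p n x p_prime.
have p_odd : odd p by case/even_prime: p_prime p_gt5 => // ->.
have pa1 : pintegral p (a + 1) by apply: (pintegralD _ _ _ p_prime _ (pnat 1%N)).
have pa1V : pintegral p (a + 1)^-1.
  by apply: pintegralV => //; move: a_neqN1; rewrite /pcongr opprK expr1.
(* Besides a + 1, its translate a + 1 - p must be a unit: it is the divisor in the boundary term
   expressed through t_p(a). *)
have na1p : ~~ pintegral p ((a + 1 - p%:R) / p%:R).
  apply: contra a_neqN1 => h; rewrite /pcongr opprK expr1.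
  have -> : (a + 1) / p%:R = (a + 1 - p%:R) / p%:R + 1 by field.
  by apply: (pintegralD _ _ _ p_prime _ (pnat 1%N)).
have a1 : a + 1 != 0.
  apply: contraNneq a_neqN1 => h; rewrite /pcongr opprK h mul0r; exact: (pnat 0%N).
have a1p : a + 1 - p%:R != 0.
  by apply: contraNneq na1p => ->; rewrite mul0r; exact: (pnat 0%N).
have pa1pV : pintegral p (a + 1 - p%:R)^-1.
  by apply: pintegralV => //; apply: pintegralB.
have p15 : pintegral p 15^-1.
  apply: pintegral_invn => //; rewrite (@Euclid_dvdM 3 5) // negb_or.
  by rewrite !dvdn_prime2 //; case: eqP p_gt5 => [->|_] //; case: eqP => [->|].
set P := 4 * a ^+ 4 + 6 * a ^+ 3 - a ^+ 2 + a + 5.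
(* At n = p the quadratic in the telescoped boundary term is 2P + pQ, so only 2P survives modulo
   p. *)
pose Q := 4 * a ^+ 2 - 2 * a - 14 + 6 * p%:R.
have pP : pintegral p P.
  exact: (pD _ _ (pD _ _ (pD _ _ (pD _ _ (pM _ _ (pnat 4%N) (pX 4%N _ a_int))
    (pM _ _ (pnat 6%N) (pX 3%N _ a_int))) (pN _ (pX 2%N _ a_int))) a_int) (pnat 5%N)).
have pQ : pintegral p Q.
  exact: (pD _ _ (pD _ _ (pD _ _ (pM _ _ (pnat 4%N) (pX 2%N _ a_int))
    (pN _ (pM _ _ (pnat 2%N) a_int))) (pN _ (pnat 14%N))) (pM _ _ (pnat 6%N) (pnat p))).
(* This is the boundary term stripped of p^3; on the right the 2 in 2P cancels the 1/2 in the
   residue of t_p(a). *)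
have main : pcongr p 1
    ((2 * P + p%:R * Q) * - summand a p * (15^-1 * (a + 1 - p%:R)^-1))
    (2 * P * - (- (a' * (a' + 1)) / 2) * (15^-1 * (a + 1)^-1)).
  have p2 : pintegral p 2^-1.
    by apply: pintegral_invn => //; rewrite gtnNdvd //; apply: leq_trans p_gt5.
  have pt : pintegral p (- (- (a' * (a' + 1)) / 2)).
    exact: (pN _ (pM _ _ (pN _ (pM _ _ pa' (pD _ _ pa' (pnat 1%N)))) p2)).
  have p2P := pM _ _ (pnat 2%N) pP.
  have hP := pcongr_addMp p (2 * P) Q p_prime pQ.
  have ht : pcongr p 1 (- summand a p) (- (- (a' * (a' + 1)) / 2)).
    by apply: pcongrN => //; rewrite {1}aE; apply: summand_prime.
  have hV : pcongr p 1 (a + 1 - p%:R)^-1 (a + 1)^-1.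
    apply: pcongrV => //; rewrite -mulrN1.
    exact: (pcongr_addMp _ _ _ p_prime (pN _ (pnat 1%N))).
  apply: (pcongrM _ _ _ _ _ _ p_prime (pM _ _ p2P pt) (pM _ _ p15 pa1V)).
    exact: (pcongrM _ _ _ _ _ _ p_prime p2P pt hP ht).
  exact: (pcongrM _ _ _ _ _ _ p_prime p15 pa1V (pcongr_refl _ _ _ p_prime) hV).
have tel : \sum_(k < p) k%:R ^+ 3 * summand a k =
    a ^+ 2 * (a + 1) ^+ 2 * (2 * a + 1) ^+ 2 / 15 * Ssum p a
    - (a + 1) ^+ 2 * (4 * a ^+ 2 * (a + 1) ^+ 2 - a * (a + 1) + 1) / 15
      * Ssum p (a + 1)
    + (2 * P + p%:R * Q) * - summand a p * (15^-1 * (a + 1 - p%:R)^-1) * p%:R ^+ 3.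
  (* The boundary term comes with t_(p-1)(a); trading it for t_p(a) by the recurrence yields the
     factor p^3 and the divisor a + 1 - p. *)
  have := sum_cubes_telescope a p.-1 a1; have := summandS a p.-1.
  have -> : p.-1%:R = p%:R - 1 :> rat by rewrite -subn1 natrB ?prime_gt0.
  rewrite prednK ?prime_gt0 // => -> ->; congr (_ + _).
  by rewrite /P /Q; field; rewrite a1p p0.
rewrite -[X in pcongr _ _ X _]/(\sum_(k < p) k%:R ^+ 3 * summand a k) tel.
apply: (pcongrD _ _ _ _ _ _ p_prime (pcongr_refl _ _ _ p_prime)).
(* Dividing by p^4 a difference that carries p^3 is the division by p in [main], so both claims
   concern the same rational number. *)
move: main; rewrite /pcongr -/P; congr (is_true (pintegral _ _)).
by clearbody a' P Q; move: (summand a p) => t; field; rewrite a1 a1p p0.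
Qed.
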